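(* Let $d\ge1$, $D=\{1,\dots,d\}$, let $X=(X_1,\dots,X_d)\sim P_X$ be a random vector with values in a product $E=E_1\times\dots\times E_d$ of Polish spaces, and let $G:E\to Z$ be a measurable function into a Polish space $Z$. Let $k:Z\times Z\to\mathbb{R}$ be the reproducing kernel of a reproducing kernel Hilbert space $\mathcal{H}$. Write $P_Y$ for the distribution of $G(X)$ and $P_{Y\mid X_A}$ for the conditional distribution of $G(X)$ given $X_A$. Assume that $k$ is such that, for all $A\in\mathcal{P}(D)$, $$S^{\mathrm{MMD}}_A:=\mathbb{E}_{X_A}\left[\mathrm{MMD}^2(P_Y,P_{Y\mid X_A})\right]$$ is well-defined and $S^{\mathrm{MMD}}_A<\infty$. Then $S^{\mathrm{MMD}}:=\mathbb{E}\left[\mathrm{MMD}^2(P_Y,P_{Y\mid X})\right]$ admits the following Möbius decomposition: $$S^{\mathrm{MMD}}=\sum_{A\in\mathcal{P}(D)}\psi_A,\qquad\text{where, for all }A\in\mathcal{P}(D),\quad \psi_A=\sum_{B\subseteq A}(-1)^{|A|-|B|}\,S^{\mathrm{MMD}}_B .$$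
   Context: $\mathcal{P}(D)$ is the power set of $D$, $|A|$ the cardinality of $A$. For $A\subseteq D$, $X_A=(X_i)_{i\in A}$, so $X_D=X$; $X_\emptyset$ is trivial, so $P_{Y\mid X_\emptyset}=P_Y$. Conditional distributions are taken to be regular. No independence of the $X_i$ is assumed. The kernel mean embedding of $G(X)$ is $\mu_G(t)=\int_Z k(z,t)\,dP_Y(z)=\mathbb{E}[k(G(X),t)]$, and the conditional embedding given $X_A$ is $\mu_{G\mid X_A}(t)=\int_Z k(z,t)\,dP_{Y\mid X_A}(z)=\mathbb{E}[k(G(X),t)\mid X_A]$ (so $\mu_{G\mid X}(t)=k(G(X),t)$). The squared maximum mean discrepancy is $\mathrm{MMD}^2(P_Y,P_{Y\mid X_A})=\|\mu_G-\mu_{G\mid X_A}\|_{\mathcal{H}}^2$; well-definedness presupposes that these embeddings exist as elements of $\mathcal{H}$ (almost surely for the conditional ones). A Möbius decomposition of a quantity of interest $q\in\mathbb{R}$ is an identity $q=\sum_{A\in\mathcal{P}(D)}\psi_A$ with $\psi_A=\sum_{B\subseteq A}(-1)^{|A|-|B|}\varphi_B$ for a set function $\varphi$ on $\mathcal{P}(D)$ with $\varphi_D=q$; here $\varphi_A=S^{\mathrm{MMD}}_A$. *)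

(* Defs.v *)
From HB Require Import structures.
From mathcomp Require Import all_boot all_order all_algebra.
From mathcomp Require Import all_classical all_reals all_analysis.

Set Implicit Arguments.
Unset Strict Implicit.
Unset Printing Implicit Defensive.

Import Order.TTheory GRing.Theory Num.Theory.
Import numFieldNormedType.Exports.
Local Open Scope classical_set_scope.
Local Open Scope ring_scope.

(* Complete metrizability is expressed by a homeomorphism (f, with inverse g)
   onto a complete metric space M. *)
Definition polish (R : realType) (T : topologicalType) : Prop :=
  (exists2 S : set T, countable S & dense S) /\
  exists (M : metricType R) (f : T -> M) (g : M -> T),
    [/\ cancel f g, cancel g f, continuous f, continuous g &
        forall F : set_system M, ProperFilter F -> cauchy F ->
          exists x : M, F --> x].

(* Topological spaces are pointed because a measurableType is; a space carrying
   a random element is nonempty, so this is no restriction. *)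
Notation borel T := (g_sigma_algebraType (@open T)).

HB.instance Definition _ (I : Type) (E : I -> ptopologicalType) :=
  Pointed.copy (prod_topology E) (forall i, E i).

Section subproduct.
Variables (I : finType) (E : I -> ptopologicalType) (A : {set I}).

(* For A = set0 this is a one-point space. *)
Definition subprod := prod_topology (fun i : {i : I | i \in A} => E (val i)).
HB.instance Definition _ := Topological.on subprod.
HB.instance Definition _ := Pointed.on subprod.

Definition restr (x : borel (prod_topology E)) : borel subprod :=
  fun i => x (val i).

Lemma continuous_restr :
  continuous (restr : prod_topology E -> subprod).
Proof.
move=> x; apply/cvg_sup => i U /= [V [[W oW WV] Vx] VU].
apply: (@filterS _ _ _ (@proj I E (val i) @^-1` W)).
  by move=> y Wy; apply: VU; rewrite -WV.
apply: (@proj_continuous I E (val i) x); apply: open_nbhs_nbhs; split => //.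
by move: Vx; rewrite -WV.
Qed.

Lemma measurable_restr : measurable_fun setT restr.
Proof.
apply: (@measurability _ _ _ _ setT restr (@open subprod) erefl) => _ [U oU <-].
rewrite setTI; apply: sub_sigma_algebra.
by move/continuousP : continuous_restr; exact.
Qed.

HB.instance Definition _ :=
  isMeasurableFun.Build _ _ _ _ restr measurable_restr.

End subproduct.
Arguments restr {I} E A _.

(* H is identified with a space of functions on Z through the injective linear
   map ev. *)
Record is_rkhs (R : realType) (Z : Type) (k : Z -> Z -> R)
    (H : completeNormedModType R) (ip : {dot H for idfun})
    (ev : H -> Z -> R) : Prop := IsRKHS {
  rkhs_norm : forall f : H, `|f| ^+ 2 = ip f f ;
  rkhs_linear : forall (a : R) (f g : H) (t : Z),
    ev (a *: f + g) t = a * ev f t + ev g t ;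
  rkhs_inj : injective ev ;
  rkhs_repr : forall t : Z, exists2 kt : H, ev kt = k^~ t &
    forall f : H, ip f kt = ev f t }.

Section mean_embedding.
Context (d : measure_display) (Z : measurableType d) (R : realType).
Variables (k : Z -> Z -> R) (H : completeNormedModType R) (ev : H -> Z -> R).
Implicit Types Q : {measure set Z -> \bar R}.

Definition is_mean_embedding Q (h : H) : Prop :=
  forall t : Z, Q.-integrable setT (fun z => (k z t)%:E) /\
                ev h t = \int[Q]_z k z t.

Definition has_mean_embedding Q : Prop := exists h, is_mean_embedding Q h.

(* Unique when ev is injective; the default 0 is only used for measures
   without a mean embedding. *)
Definition mean_embedding Q : H := xget 0 (is_mean_embedding Q).

Definition mmd2 Q Q' : R := `|mean_embedding Q - mean_embedding Q'| ^+ 2.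

End mean_embedding.

Section conditional.
Context (dO dV dZ : measure_display) (Omega : measurableType dO)
  (V : measurableType dV) (Z : measurableType dZ) (R : realType)
  (P : probability Omega R).
Variables (W : {mfun Omega >-> V}) (Y : {mfun Omega >-> Z})
  (K : R.-pker V ~> Z).

(* K is a version of the regular conditional distribution of Y given W. *)
Definition is_cond_distribution : Prop :=
  forall (B : set V) (C : set Z), measurable B -> measurable C ->
    P (W @^-1` B `&` Y @^-1` C) = (\int[distribution P W]_(v in B) K v C)%E.

Variables (k : Z -> Z -> R) (H : completeNormedModType R) (ev : H -> Z -> R).

Definition cond_mmd2 (v : V) : R := mmd2 k ev (distribution P Y) (K v).

Definition mean_mmd2 : \bar R := ('E_(distribution P W)[cond_mmd2])%E.

(* The squared discrepancy is only defined almost surely, so measurability is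
   required up to a null set. *)
Definition mean_mmd2_well_defined : Prop :=
  [/\ has_mean_embedding k ev (distribution P Y),
      {ae distribution P W, forall v, has_mean_embedding k ev (K v)} &
      exists2 g : V -> R, measurable_fun setT g &
        {ae distribution P W, forall v, cond_mmd2 v = g v}].

End conditional.

Definition mobius_coef (R : pzRingType) (I : finType) (phi : {set I} -> R)
    (A : {set I}) : R :=
  \sum_(B : {set I} | B \subset A) (-1) ^+ (#|A| - #|B|) * phi B.

Definition mobius_decomposition (R : pzRingType) (I : finType) (q : R)
    (phi : {set I} -> R) : Prop :=
  phi [set: I]%SET = q /\ q = \sum_(A : {set I}) mobius_coef phi A.

(* Main.v *)
(** Summing the Moebius coefficients over all [A] gives [phi D] for any set
    function [phi], because the signs of the supersets of a proper subset cancel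
    in pairs [A], [A :|: {i}].  It remains to identify [S_D] with [S].  Restriction
    to all coordinates generates the sigma-algebra of [X], so [K_D] and [KX] are
    two versions of the same conditional distribution.  The Borel sets of [Z] are
    generated by a countable pi-system, so the two versions coincide as measures
    outside one null set, and hence so do the discrepancies.  The discrepancy is
    only almost everywhere equal to a measurable function, which suffices for the
    integrals of nonnegative functions to agree. *)

Require Import Defs.
From HB Require Import structures.
From mathcomp Require Import all_boot all_order all_algebra.
From mathcomp Require Import all_classical all_reals all_analysis.
From mathcomp Require Import measurable_realfun.

Import Order.TTheory GRing.Theory Num.Theory.
Import numFieldNormedType.Exports.
Local Open Scope classical_set_scope.
Local Open Scope ring_scope.

(** * Möbius inversion on subsets *)

Lemma sum_sign_supersets (R : pzRingType) (I : finType) (B : {set I}) :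
  \sum_(A : {set I} | B \subset A) (-1) ^+ (#|A| - #|B|) =
  (B == [set: I]%SET)%:R :> R.
Proof.
have [->|BT] := eqVneq B [set: I]%SET.
  by rewrite (big_pred1 [set: I]%SET) ?subnn// => A; rewrite /= finset.subTset.
have [i iB] : exists i, i \notin B.
  by apply/existsP; rewrite -negb_forall; apply: contra BT => /forallP h;
     apply/eqP/setP => j; rewrite inE (h j).
(* The supersets containing [i] are reindexed as [i |: A] with [i \notin A]; adding [i] raises the
   cardinality by one and flips the sign. *)
rewrite (bigID (fun A : {set I} => i \in A))/=.
rewrite (reindex_onto (fun A : {set I} => i |: A)%SET (fun A => A :\ i)%SET)/=;
  last by move=> A /andP[_ iA]; rewrite finset.setD1K.
rewrite (eq_bigl (fun A : {set I} => (B \subset A) && (i \notin A))); last first.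
  move=> A; rewrite finset.setU11 andbT; apply/andP/andP => -[].
    move=> BA /eqP AE; have iA : i \notin A by rewrite -AE setD11.
    split=> //; apply/fintype.subsetP => j jB; have := fintype.subsetP BA _ jB.
    by rewrite !inE => /orP[/eqP ji|//]; rewrite -ji jB in iB.
  move=> BA iA; split; last by rewrite setU1K.
  by apply: (fintype.subset_trans BA); exact: finset.subsetUr.
rewrite -big_split big1//= => A /andP[BA iA].
by rewrite cardsU1 iA add1n subSn ?subset_leq_card// exprS mulN1r addNr.
Qed.

Lemma sum_mobius_coef (R : pzRingType) (I : finType) (phi : {set I} -> R) :
  \sum_(A : {set I}) mobius_coef phi A = phi [set: I]%SET.
Proof.
rewrite /mobius_coef (exchange_big_dep xpredT)//=.
rewrite (bigD1 [set: I]%SET)//= -mulr_suml sum_sign_supersets eqxx mul1r.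
rewrite big1 ?addr0// => B BT.
by rewrite -mulr_suml sum_sign_supersets (negbTE BT) mul0r.
Qed.

(** * Countable generation of the Borel sets of a Polish space *)

Lemma polish_second_countable (R : realType) (T : topologicalType) :
  polish R T -> @second_countable T.
Proof.
move=> [[S cS dS] [M [f [g [fgK gfK cf cg _]]]]].
pose U s n : set T := f @^-1` (ball (f s) n.+1%:R^-1)^°.
have Fopen (B : set M) : open (f @^-1` B^°).
  by apply: open_comp; [move=> x _; exact: cf|exact: open_interior].
exists [set U x.1 x.2 | x in S `*` [set: nat]].
  by apply: (card_le_trans (card_image_le _ _)); exact: countableX.
split; first by move=> _ [x _ <-]; exact: Fopen.
move=> x V xV.
have : nbhs (f x) (g @^-1` V) by apply: cg; rewrite fgK.
move=> /nbhs_ballP[_/posnumP[e] eV].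
(* The radius [r] is below [e / 2], and the centre is chosen within [r / 2] of [f x]. Hence the
   basic set contains the preimage of the [r / 2]-ball about [f x], and its image stays within
   distance [e] of [f x]. *)
have [//|N] := @ltr_add_invr R 0 (e%:num / 2); rewrite add0r => Ne.
pose r : R := N.+1%:R^-1.
have r2 : 0 < r / 2 by rewrite divr_gt0// invr_gt0.
have xball : (f @^-1` (ball (f x) (r / 2))^°) x.
  by rewrite /preimage/=; apply: nbhs_singleton; apply: nbhs_interior;
     exact: nbhsx_ballx.
have [s [/= sU sS]] := dS _ (ex_intro _ x xball) (Fopen _).
have xs : ball (f x) (r / 2) (f s) by exact: interior_subset.
exists (U s N); first split => //=.
- by exists (s, N).
- rewrite /U/preimage/=.
  apply: filterS (nbhsx_ballx (f x) _ r2) => z xz.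
  by rewrite -/r [r]splitr; apply: ball_triangle xz; exact: ball_sym.
- move=> z /interior_subset/= sz; rewrite -(fgK z); apply: eV.
  rewrite [_%:num]splitr; apply: (@ball_triangle _ _ (f s)).
    apply: le_ball xs; apply: le_trans (ltW Ne).
    by rewrite ler_pdivrMr// ler_peMr ?invr_ge0// ler1n.
  exact: le_ball (ltW Ne) _ sz.
Qed.

(** The members are finite intersections of basic open sets. Indexing them by lists of codes keeps
    the family countable and turns intersection into concatenation. *)
Lemma second_countable_pi_system (T : ptopologicalType) :
  @second_countable T ->
  exists G : seq nat -> set T,
    [/\ G [::] = setT, forall s t, G s `&` G t = G (s ++ t) &
        @measurable _ (borel T) = <<s range G>>].
Proof.
move=> [B /countable_injP[f finj] [Bopen Bnbhs]].
(* A number that codes no basic set gets the default [setT], so every [e n] is open. *)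
pose e n : set T := xget setT [set U | B U /\ f U = n].
have eB U : B U -> e (f U) = U.
  move=> BU; rewrite /e; case: xgetP => [V _ [BV fUV]|/(_ U)]; last by case.
  by apply: finj => //; rewrite inE.
have eopen n : open (e n).
  by rewrite /e; case: xgetP => [V _ [/Bopen]//|_]; exact: openT.
pose G (s : seq nat) : set T := \big[setI/setT]_(n <- s) e n.
exists G; split; first by rewrite /G big_nil.
- by move=> s t; rewrite /G big_cat.
apply/seteqP; split.
- apply: smallest_sub; first exact: smallest_sigma_algebra.
  move=> U oU.
  have -> : U = \bigcup_(n in [set n | e n `<=` U]) e n.
    apply/seteqP; split => [x Ux|x [n /= nU /nU//]].
    have [V [BV Vx] VU] := Bnbhs x U (open_nbhs_nbhs (conj oU Ux)).
    by exists (f V); rewrite /= eB.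
  apply: (@bigcup_measurable _ (g_sigma_algebraType (range G))) => n _.
  by apply: sub_sigma_algebra; exists [:: n] => //; rewrite /G big_seq1.
- apply: smallest_sub; first exact: smallest_sigma_algebra.
  move=> _ [s _ <-]; rewrite /G.
  elim/big_ind: _ => [|U V|n _].
  + exact: (@measurableT _ (borel T)).
  + exact: (@measurableI _ (borel T)).
  + exact: sub_sigma_algebra.
Qed.

(** * Almost sure uniqueness of kernels *)

Lemma ae_eq_kernel (R : realType) (Z : ptopologicalType) (d : measure_display)
    (V : measurableType d) (mu : probability V R)
    (K L : V -> {measure set borel Z -> \bar R}) :
  @second_countable Z ->
  (forall C, measurable C -> measurable_fun setT (K ^~ C)) ->
  (forall C, measurable C -> measurable_fun setT (L ^~ C)) ->
  (forall v, K v setT = 1%E) -> (forall v, L v setT = 1%E) ->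
  (forall B C, measurable B -> measurable C ->
    (\int[mu]_(v in B) K v C = \int[mu]_(v in B) L v C)%E) ->
  {ae mu, forall v, forall C, measurable C -> K v C = L v C}.
Proof.
move=> /second_countable_pi_system[G [G0 GI Gm]] mK mL K1 L1 KL.
have mG s : measurable (G s : set (borel Z)).
  by rewrite Gm; apply: sub_sigma_algebra; exists s.
(* For a fixed set, equal integrals over all [B] give equality outside a null set depending on that
   set. Numbering the lists by [unpickle] leaves countably many null sets; a number coding no list
   is read as [[::]]. *)
have KLG n : {ae mu, forall v,
    K v (G (odflt [::] (unpickle n))) = L v (G (odflt [::] (unpickle n)))}.
  set C := G _; have mC : measurable (C : set (borel Z)) by exact: mG.
  suff : ae_eq mu setT (K ^~ C) (L ^~ C) by apply: filterS => v; apply.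
  apply: integral_ae_eq => //.
  - apply: (@le_integrable _ _ _ _ _ _ _ (cst 1%E)) => //.
    + exact: mK.
    + move=> v _; rewrite /= gee0_abs// normr1 -(K1 v).
      by apply: le_measure; rewrite ?inE.
    + exact: finite_measure_integrable_cst.
  - exact: mL.
  - by move=> E _ mE; exact: KL.
apply: filterS (ae_foralln KLG) => v KLv C mC.
apply: (@measure_unique _ _ (borel Z) (range G) (fun=> setT)) => //.
- by move=> _ _ [s _ <-] [t _ <-]; rewrite GI; exists (s ++ t).
- by move=> _; exists [::].
- by rewrite bigcup_const//; exists 0%N.
- by move=> _ [s _ <-]; have := KLv (pickle s); rewrite pickleK.
- by move=> _; rewrite K1 ltry.
Qed.

(** * Integrals of functions measurable up to a null set *)

(** The integral is a supremum over the simple functions below the integrand, and those below [f]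
    are also below [g]. *)
Lemma ge0_le_integral_nonmeasurable (d : measure_display) (T : measurableType d)
    (R : realType) (mu : {measure set T -> \bar R}) (f g : T -> \bar R) :
  (forall x, 0 <= f x)%E -> (forall x, f x <= g x)%E ->
  (\int[mu]_x f x <= \int[mu]_x g x)%E.
Proof.
move=> f0 fg; rewrite !ge0_integralTE//; last first.
  by move=> x; exact: le_trans (fg x).
apply: le_ereal_sup => _ [h hf <-]; exists h => // x.
exact: le_trans (hf x) (fg x).
Qed.

Lemma ge0_ae_eq_integral_nonmeasurable (d : measure_display)
    (T : measurableType d) (R : realType) (mu : {measure set T -> \bar R})
    (f g : T -> \bar R) :
  measurable_fun setT g -> (forall x, 0 <= f x)%E -> (forall x, 0 <= g x)%E ->
  {ae mu, forall x, f x = g x} ->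
  (\int[mu]_x f x = \int[mu]_x g x)%E.
Proof.
move=> mg f0 g0 [N [mN N0 fgN]].
have fgE x : x \notin N -> f x = g x.
  by rewrite notin_setE => Nx; apply: contrapT => fgx; exact/Nx/fgN.
(* [f] lies between two measurable modifications of [g] on [N]. *)
pose h (c : \bar R) x := if x \in N then c else g x.
have h0 c : (0 <= c)%E -> forall x, (0 <= h c x)%E.
  by move=> c0 x; rewrite /h; case: ifP.
have hg c : (0 <= c)%E -> (\int[mu]_x h c x = \int[mu]_x g x)%E.
  move=> c0; apply: ge0_ae_eq_integral => //.
  - apply: measurable_fun_ifT => //.
    apply: (@measurable_fun_bool _ _ setT (fun x => x \in N) true).
    by rewrite setTI -/(mem N @^-1` _) preimage_mem_true.
  - by move=> x _; exact: h0.
  - exists N; split => // x /= hx; apply: contrapT => Nx; apply: hx => _.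
    by rewrite /h memNset.
(* The value [+oo] on [N] gives the upper bound for [f], the value [0] the lower one. *)
apply/eqP; rewrite eq_le; apply/andP; split.
- rewrite -(hg +oo%E)//; apply: ge0_le_integral_nonmeasurable => // x.
  by rewrite /h; case: ifPn => [_|/fgE->//]; rewrite leey.
- rewrite -(hg 0%E)//; apply: ge0_le_integral_nonmeasurable => [|x].
    exact: h0.
  by rewrite /h; case: ifPn => [_|/fgE->//].
Qed.

(** * Discrepancies under a change of conditioning variable *)

Section mmd.
Context {d : measure_display} {Z : measurableType d} {R : realType}.
Variables (k : Z -> Z -> R) (H : completeNormedModType R) (ev : H -> Z -> R).
Implicit Types Q : {measure set Z -> \bar R}.

Lemma eq_mean_embedding Q Q' :
  (forall C, measurable C -> Q C = Q' C) ->
  mean_embedding k ev Q = mean_embedding k ev Q'.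
Proof.
(* [xget] chooses the same element once the two predicates are equal as sets. *)
move=> QQ'; rewrite /mean_embedding; congr (xget 0 _).
apply/funext => h; apply/propext.
have intE (f : Z -> \bar R) : (\int[Q]_z f z = \int[Q']_z f z)%E.
  by apply: eq_measure_integral => A mA _; exact: QQ'.
split=> hQ t; have [/integrableP[mk ik] ->] := hQ t.
- by split; [apply/integrableP; split; rewrite // -intE|rewrite /Rintegral intE].
- by split; [apply/integrableP; split; rewrite // intE|rewrite /Rintegral intE].
Qed.

Lemma mmd2_ge0 Q Q' : 0 <= mmd2 k ev Q Q'.
Proof. exact: exprn_ge0. Qed.

End mmd.

Section conditioning_generator.
Context {dO dV dV' : measure_display} {Omega : measurableType dO}
  {V : measurableType dV} {V' : measurableType dV'} {Z : ptopologicalType}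
  {R : realType} {P : probability Omega R} {W : {mfun Omega >-> V}}
  {r : {mfun V >-> V'}} {Y : {mfun Omega >-> borel Z}}
  {K : R.-pker V ~> borel Z} {K' : R.-pker V' ~> borel Z}.
(** Consequently [r \o W] and [W] generate the same sigma-algebra on [Omega]. *)
Hypothesis r_gen : forall B : set V, measurable B ->
  exists2 B' : set V', measurable B' & B = r @^-1` B'.
Hypotheses (Z2 : @second_countable Z) (condK : is_cond_distribution P W Y K)
  (condK' : is_cond_distribution P (r \o W) Y K').

(** Composing [K'] with [r] yields another version of the conditional distribution given [W]: write
    [B] as a preimage under [r] and change variables along [r]. *)
Lemma ae_eq_cond_distribution :
  {ae distribution P W, forall v,
    forall C, measurable C -> K v C = K' (r v) C}.
Proof.
apply: (@ae_eq_kernel _ _ _ _ _ K (fun v => K' (r v))) => //.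
- by move=> C mC; exact: measurable_kernel.
- by move=> C mC; apply: (measurableT_comp (measurable_kernel K' C mC)).
- by move=> v; exact: prob_kernel.
- by move=> v; exact: prob_kernel.
move=> B C mB mC; have [B' mB' BE] := r_gen _ mB.
rewrite -condK// BE -[LHS]/(P ((r \o W) @^-1` B' `&` Y @^-1` C)) condK'//.
rewrite -(@ge0_integral_pushforward _ _ _ _ _ r _ (distribution P W) B' (K' ^~ C))//.
by apply: measurable_funTS; exact: measurable_kernel.
Qed.

Lemma eq_mean_mmd2 (k : Z -> Z -> R) (H : completeNormedModType R)
    (ev : H -> Z -> R) :
  mean_mmd2_well_defined P (r \o W) Y K' k ev ->
  mean_mmd2 P W Y K k ev = mean_mmd2 P (r \o W) Y K' k ev.
Proof.
move=> [_ _ [g mg K'g]]; rewrite /mean_mmd2 unlock.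
(* [g] may be negative on the null set; its absolute value is nonnegative everywhere and still
   agrees almost everywhere with the discrepancy. *)
have mgE : measurable_fun setT (EFin \o (fun v => `|g v|)).
  by apply/measurable_EFinP; exact: measurableT_comp.
have gE v' : cond_mmd2 P Y K' k ev v' = g v' ->
    (cond_mmd2 P Y K' k ev v')%:E = `|g v'|%:E.
  by move=> <-; rewrite ger0_norm// mmd2_ge0.
rewrite [RHS](@ge0_ae_eq_integral_nonmeasurable _ _ _ _ _
  (EFin \o (fun v => `|g v|)))//; first last.
- by apply: filterS K'g => v' /gE.
- by move=> v'; rewrite /= lee_fin.
- by move=> v'; rewrite /= lee_fin mmd2_ge0.
rewrite [RHS](@ge0_integral_pushforward _ _ _ _ _ r _ (distribution P W) setT)//;
  last by move=> v' _; rewrite /= lee_fin.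
rewrite preimage_setT.
apply: ge0_ae_eq_integral_nonmeasurable => //.
- exact: measurableT_comp.
- by move=> v; rewrite /= lee_fin mmd2_ge0.
- by move=> v; rewrite /= lee_fin.
have K'gr : {ae distribution P W, forall v, cond_mmd2 P Y K' k ev (r v) = g (r v)}.
  (* The law of [r \o W] is the image under [r] of the law of [W], so preimages of null sets are
     null. *)
  have [N [mN N0 NP]] := K'g; exists (r @^-1` N); split => //.
    by rewrite -[r @^-1` N]setTI; exact: measurable_funP.
  by move=> v /NP.
apply: filterS2 K'gr ae_eq_cond_distribution => v gv KK'.
by rewrite /= -gE// /cond_mmd2 /mmd2 (@eq_mean_embedding _ (borel Z) _ k _ ev _ _ KK').
Qed.

End conditioning_generator.

(** * Full restriction and the decomposition *)

Lemma restr_setT_preimage (I : finType) (E : I -> ptopologicalType)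
    (B : set (borel (prod_topology E))) :
  measurable B ->
  exists2 B' : set (borel (subprod E [set: I]%SET)), measurable B' &
    B = restr E [set: I]%SET @^-1` B'.
Proof.
(* [s] undoes the restriction and is continuous, hence Borel; the required [B'] is the preimage of
   [B] under [s]. *)
pose s (y : borel (subprod E [set: I]%SET)) : borel (prod_topology E) :=
  fun i => y (exist _ i (finset.in_setT i)).
have cs : continuous (s : subprod E [set: I]%SET -> prod_topology E).
  move=> y; apply/cvg_sup => i U /= [V [[W oW WV] Vy] VU].
  pose j : {i | i \in [set: I]%SET} := exist _ i (finset.in_setT i).
  apply: (@filterS _ _ _ (@proj _ (fun j => E (val j)) j @^-1` W)).
    by move=> z Wz; apply: VU; rewrite -WV.
  apply: (@proj_continuous _ (fun j => E (val j)) j y).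
  by apply: open_nbhs_nbhs; split => //; move: Vy; rewrite -WV.
have ms : measurable_fun setT s.
  apply: (@measurability _ _ _ _ setT s (@open (prod_topology E)) erefl).
  move=> _ [U oU <-]; rewrite setTI; apply: sub_sigma_algebra.
  by move/continuousP : cs; exact.
by move=> mB; exists (s @^-1` B) => //; rewrite -[s @^-1` B]setTI; exact: ms.
Qed.

Theorem proposition4 (R : realType) (d : nat) (d_gt0 : (0 < d)%N)
  (E : 'I_d -> ptopologicalType) (polishE : forall i, polish R (E i))
  (Z : ptopologicalType) (polishZ : polish R Z)
  (dO : measure_display) (Omega : measurableType dO) (P : probability Omega R)
  (X : {mfun Omega >-> borel (prod_topology E)})
  (G : {mfun borel (prod_topology E) >-> borel Z})
  (k : Z -> Z -> R) (H : completeNormedModType R) (ip : {dot H for idfun})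
  (ev : H -> Z -> R) (rkhsH : is_rkhs k ip ev)
  (* P_{Y|X_A} for every A, and P_{Y|X}, with Y = G(X) *)
  (K : forall A : {set 'I_d}, R.-pker borel (subprod E A) ~> borel Z)
  (condK : forall A : {set 'I_d},
     is_cond_distribution P (restr E A \o X) (G \o X) (K A))
  (KX : R.-pker borel (prod_topology E) ~> borel Z)
  (condKX : is_cond_distribution P X (G \o X) KX)
  (S_well_defined : forall A : {set 'I_d},
     mean_mmd2_well_defined P (restr E A \o X) (G \o X) (K A) k ev)
  (S_finite : forall A : {set 'I_d},
     (mean_mmd2 P (restr E A \o X) (G \o X) (K A) k ev < +oo)%E) :
  mean_mmd2 P X (G \o X) KX k ev \is a fin_num /\
  mobius_decomposition
    (fine (mean_mmd2 P X (G \o X) KX k ev))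
    (fun A : {set 'I_d} =>
       fine (mean_mmd2 P (restr E A \o X) (G \o X) (K A) k ev)).

Proof.
set K0 := mean_mmd2 P X _ KX k ev.
have K0E : K0 = mean_mmd2 P (restr E [set: 'I_d]%SET \o X) (G \o X)
    (K [set: 'I_d]%SET) k ev.
  (* Here [W] is [X] and [r] is the restriction to all coordinates. *)
  apply: eq_mean_mmd2 => //.
  - exact: restr_setT_preimage.
  - exact: polish_second_countable polishZ.
have K0_fin : K0 \is a fin_num.
  rewrite ge0_fin_numE; first by rewrite K0E.
  by apply: expectation_ge0 => v; exact: mmd2_ge0.
by split=> //; split; rewrite ?sum_mobius_coef K0E.
Qed.
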